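(* For any given penalty parameter $\rho\ge 0$ and switching cost $c\ge 0$, the penalized problem: find $u^\rho=(u^{\rho,i})_{i\in\mathcal I}\in\mathbb R^{N\times d}$ such that $$F_i(u^{\rho})_l-\rho\sum_{j\neq i}\pi\big(u^{\rho,j}_l-c-u^{\rho,i}_l\big)=0,\qquad i\in\mathcal I,\ l\in\mathcal N,$$ admits a unique solution $u^\rho$, and it satisfies $\|u^\rho\|\le \|F(0)\|/\gamma$.
   Context: Let $N\ge1$ and $d\ge 2$ be integers, $\mathcal I=\{1,\dots,d\}$, $\mathcal N=\{1,\dots,N\}$. An element $u\in\mathbb R^{N\times d}$ is written $u=(u^1,\dots,u^d)$ with $u^i\in\mathbb R^N$ and entries $u^i_l$, $l\in\mathcal N$. $\|\cdot\|$ denotes the sup-norm, i.e. the maximum of the absolute values of the entries. $F=(F_i)_{i\in\mathcal I}:\mathbb R^{N\times d}\to\mathbb R^{N\times d}$ (with $F_i(u)\in\mathbb R^N$) is a continuous function satisfying the monotonicity condition: there is a constant $\gamma>0$ such that for any $u,v\in\mathbb R^{N\times d}$, $i\in\mathcal I$, $l\in\mathcal N$ with $u^i_l-v^i_l=\max_{j\in\mathcal I,k\in\mathcal N}(u^j_k-v^j_k)\ge 0$, one has $F_i(u)_l-F_i(v)_l\ge\gamma(u^i_l-v^i_l)$. The penalty function $\pi:\mathbb R\to\mathbb R$ is a continuous non-decreasing function with $\pi|_{(-\infty,0]}=0$ and $\pi|_{(0,\infty)}>0$. *)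

(* Defs.v *)
From HB Require Import structures.
From mathcomp Require Import all_boot all_order all_algebra.
From mathcomp Require Import all_classical all_reals all_analysis.
Import Order.TTheory GRing.Theory Num.Theory.
Import numFieldNormedType.Exports.

Set Implicit Arguments.
Unset Strict Implicit.
Unset Printing Implicit Defensive.

Local Open Scope classical_set_scope.
Local Open Scope ring_scope.

(* An element u = (u^1, ..., u^d) of R^{N x d} is a matrix u : 'M[R]_(N, d) whose
   columns are the u^i: the entry u^i_l is [u l i], and F_i(u)_l is [F u l i].
   The library norm [`|u|] on matrices is the sup-norm of the entries and the
   library topology on matrices is the entrywise one. *)

Definition is_max_entry (R : realType) (N d : nat) (w : 'M[R]_(N, d))
    (l : 'I_N) (i : 'I_d) : Prop :=
  forall (k : 'I_N) (j : 'I_d), w k j <= w l i.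

Definition monotonicity_condition (R : realType) (N d : nat)
    (F : 'M[R]_(N, d) -> 'M[R]_(N, d)) (gamma : R) : Prop :=
  forall (u v : 'M[R]_(N, d)) (i : 'I_d) (l : 'I_N),
    is_max_entry (u - v) l i -> 0 <= u l i - v l i ->
    gamma * (u l i - v l i) <= F u l i - F v l i.

Definition penalty_function (R : realType) (pi : R -> R) : Prop :=
  [/\ continuous pi,
      {homo pi : x y / x <= y},
      (forall x : R, x <= 0 -> pi x = 0)
    & (forall x : R, 0 < x -> 0 < pi x)].

Definition solves_penalized (R : realType) (N d : nat)
    (F : 'M[R]_(N, d) -> 'M[R]_(N, d)) (pi : R -> R) (rho c : R)
    (u : 'M[R]_(N, d)) : Prop :=
  forall (i : 'I_d) (l : 'I_N),
    F u l i - rho * (\sum_(j < d | j != i) pi (u l j - c - u l i)) = 0.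

(* Main.v *)
(* Passing from F to F minus the penalty preserves continuity and the
   monotonicity condition.  For a map G satisfying that condition, [G u <= G v]
   entrywise implies [u <= v], and each entry of G is antitone in the other
   variables.  Perron's method then produces a zero of G as the entrywise
   supremum of all subsolutions [G v <= 0]: the constant matrices with value
   [`|G 0| / gamma] and its opposite are a super- and a subsolution, and a strict
   inequality [G u l i < 0] at the supremum u would leave room to increase the
   entry (l, i) of u alone. *)
Require Import Defs.
From HB Require Import structures.
From mathcomp Require Import all_boot all_order all_algebra.
From mathcomp Require Import all_classical all_reals all_analysis.
From mathcomp Require Import lra.
Import Order.TTheory GRing.Theory Num.Theory.
Import numFieldNormedType.Exports.
Local Open Scope classical_set_scope.
Local Open Scope ring_scope.

Section MonotoneMaps.
Context {R : realType} {N d : nat}.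
Implicit Types (u v w : 'M[R]_(N, d)) (l k : 'I_N) (i j : 'I_d).

Lemma mx_entry_le_norm u l i : `|u l i| <= `|u|.
Proof.
rewrite [leRHS]/Num.norm/= mx_normrE.
exact: (le_bigmax _ (fun p : 'I_N * 'I_d => `|u p.1 p.2|) (l, i)).
Qed.

(** The only form in which continuity enters Perron's argument, where a single entry of the supremum
    is perturbed. *)
Lemma continuous_shift_entry (g : 'M[R]_(N, d) -> R) u l i : continuous g ->
  (fun t : R => g (u + t *: delta_mx l i)) t @[t --> 0] --> g u.
Proof.
move=> cg; suff : u + t *: delta_mx l i @[t --> (0 : R)] --> u.
  by move=> /cvg_comp; apply; exact: cg.
rewrite -[X in _ --> X]addr0 -(scale0r (delta_mx l i)).
by apply: cvgD; [exact: cvg_cst|apply: cvgZr_tmp; exact: cvg_id].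
Qed.

Lemma shift_entryE u (t : R) l i k j :
  (u + t *: delta_mx l i) k j =
  if (k == l) && (j == i) then u l i + t else u k j.
Proof.
rewrite !mxE; case: ifP => [/andP[/eqP-> /eqP->]|_]; first by rewrite mulr1.
by rewrite mulr0 addr0.
Qed.

Variables (G : 'M[R]_(N, d) -> 'M[R]_(N, d)) (gamma : R).
Hypotheses (gamma_gt0 : 0 < gamma) (monG : monotonicity_condition G gamma).

(** Otherwise [u - v] has a positive maximal entry, and there the monotonicity condition makes [G u]
    strictly larger than [G v]. *)
Lemma monotone_comparison u v :
  (forall l i, G u l i <= G v l i) -> forall l i, u l i <= v l i.
Proof.
move=> Guv l i; rewrite leNgt; apply/negP => vu.
have [[k j] /= _ maxkj] :=
  @arg_maxP _ _ _ (l, i) xpredT (fun p => (u - v) p.1 p.2) isT.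
have kj_gt0 : 0 < u k j - v k j.
  by have := maxkj (l, i) isT; rewrite /= !mxE; lra.
have max_kj : is_max_entry (u - v) k j by move=> k' j'; exact: (maxkj (k', j')).
have := monG _ _ _ _ max_kj (ltW kj_gt0).
have := Guv k j; have := mulr_gt0 gamma_gt0 kj_gt0; lra.
Qed.

(** Here [u - v] attains its maximum, zero, at [(l, i)], so the condition applies with a vanishing
    lower bound. *)
Lemma monotone_off_diagonal u v l i :
  (forall k j, u k j <= v k j) -> u l i = v l i -> G v l i <= G u l i.
Proof.
move=> uv uvli; rewrite -subr_ge0.
have := monG u v i l; rewrite uvli subrr mulr0; apply => // k j.
by rewrite !mxE uvli subrr subr_le0.
Qed.

Let C := `|G 0| / gamma.

Let C_ge0 : 0 <= C.
Proof. by rewrite divr_ge0// ltW. Qed.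

Let gammaC : gamma * C = `|G 0|.
Proof. by rewrite mulrCA divff ?gt_eqF// mulr1. Qed.

(** Against [0], every entry of a constant matrix is maximal. The value [C] makes the gain
    [gamma * C] equal to [|G 0|], enough to offset any entry of [G 0]. *)
Lemma monotone_const_super l i : 0 <= G (const_mx C) l i.
Proof.
have := monG (const_mx C) 0 i l.
rewrite [const_mx C l i]mxE [fun_of_matrix 0 l i]mxE !subr0 gammaC => H.
have := mx_entry_le_norm (G 0) l i; rewrite ler_norml => /andP[? ?].
suff : `|G 0| <= G (const_mx C) l i - G 0 l i by lra.
by apply: H => // k j; rewrite !mxE.
Qed.

Lemma monotone_const_sub l i : G (const_mx (- C)) l i <= 0.
Proof.
have := monG 0 (const_mx (- C)) i l.
rewrite [const_mx (- C) l i]mxE [fun_of_matrix 0 l i]mxE !sub0r opprK gammaC => H.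
have := mx_entry_le_norm (G 0) l i; rewrite ler_norml => /andP[? ?].
suff : `|G 0| <= G 0 l i - G (const_mx (- C)) l i by lra.
by apply: H => // k j; rewrite !mxE.
Qed.

Lemma monotone_subsolution_le v l i :
  (forall k j, G v k j <= 0) -> v l i <= C.
Proof.
move=> Gv_le0; suff : v l i <= const_mx C l i by rewrite [leRHS]mxE.
apply: monotone_comparison => k j.
exact: le_trans (Gv_le0 k j) (monotone_const_super k j).
Qed.

Lemma monotone_supersolution_ge v l i :
  (forall k j, 0 <= G v k j) -> - C <= v l i.
Proof.
move=> Gv_ge0; suff : const_mx (- C) l i <= v l i by rewrite [leLHS]mxE.
apply: monotone_comparison => k j.
exact: le_trans (monotone_const_sub k j) (Gv_ge0 k j).
Qed.

Lemma monotone_zero_bound u : G u = 0 -> `|u| <= C.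
Proof.
move=> Gu0; rewrite [leLHS]/Num.norm/= mx_normrE.
apply: bigmax_le => // -[l i] _ /=.
rewrite ler_norml monotone_supersolution_ge ?monotone_subsolution_le//;
  by move=> k j; rewrite Gu0 mxE.
Qed.

Hypothesis contG : forall l i, continuous (fun u => G u l i).

Lemma monotone_zero_exists : exists u, G u = 0.
Proof.
pose S := [set v | forall l i, G v l i <= 0].
pose E l i := [set v l i | v in S].
(* A member of [S] and the common bound [C] make each [sup (E l i)] a true supremum rather than a
   default value. *)
have S_sub : S (const_mx (- C)) by exact: monotone_const_sub.
have E_ub l i : ubound (E l i) C.
  by move=> _ [v Sv <-]; exact: monotone_subsolution_le.
have E_sup l i : has_sup (E l i).
  by split; [exists (const_mx (- C) l i), (const_mx (- C))|exists C].
pose u : 'M[R]_(N, d) := \matrix_(l, i) sup (E l i).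
have le_u v l i : S v -> v l i <= u l i.
  by move=> Sv; rewrite mxE; apply: ub_le_sup; [exists C|exists v].
(* Lowering the entry (l, i) of u to a value nearly attaining the supremum gives
   a matrix above some subsolution v that agrees with v at (l, i). *)
have Su : S u.
  move=> l i; rewrite leNgt; apply/negP => Gu_gt0.
  (* With [G u l i] itself as tolerance, this entry of [G] stays positive for shifts smaller than
     [e]. *)
  have /cvgrPdist_lt/(_ _ Gu_gt0)[e /= e_gt0 He] :=
    continuous_shift_entry _ u l i (contG l i).
  have [_ [v Sv <-]] := sup_adherent e_gt0 (E_sup l i).
  have <- : u l i = sup (E l i) by rewrite mxE.
  move=> lt_v; pose t := v l i - u l i.
  have vu := le_u v l i Sv.
  have /He : `|0 - t| < e by rewrite /t ltr_norml; apply/andP; split; lra.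
  have : G (u + t *: delta_mx l i) l i <= G v l i.
    apply: monotone_off_diagonal => [k j|]; rewrite shift_entryE.
      case: ifP => [/andP[/eqP-> /eqP->]|_]; [by rewrite /t; lra|exact: le_u].
    by rewrite !eqxx /t /=; lra.
  by have := Sv l i; rewrite ltr_norml => ? ? /andP[? ?]; lra.
exists u; apply/matrixP => l i; rewrite [RHS]mxE; apply/eqP.
rewrite eq_le Su leNgt; apply/negP => Gu_lt0.
have Gu_gt0 : 0 < - G u l i by lra.
have /cvgrPdist_lt/(_ _ Gu_gt0)[e /= e_gt0 He] :=
  continuous_shift_entry _ u l i (contG l i).
pose t := e / 2; have t_gt0 : 0 < t by rewrite divr_gt0.
have /He : `|0 - t| < e by rewrite /t ltr_norml; apply/andP; split; lra.
rewrite ltr_norml => /andP[Gt _].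
(* At [(l, i)] the sign survives by the choice of [e]; at any other position, raising a foreign
   entry can only lower [G]. *)
have St : S (u + t *: delta_mx l i).
  move=> k j; have [/andP[/eqP-> /eqP->]|kj] := boolP ((k == l) && (j == i)).
    by lra.
  apply: le_trans (Su k j); apply: monotone_off_diagonal => [k' j'|].
    by rewrite shift_entryE; case: ifP => [/andP[/eqP-> /eqP->]|_]//; lra.
  by rewrite shift_entryE (negbTE kj).
by have := le_u _ l i St; rewrite shift_entryE !eqxx /=; lra.
Qed.

End MonotoneMaps.

Section Penalization.
Context {R : realType} {N d : nat}.
Variables (F : 'M[R]_(N, d) -> 'M[R]_(N, d)) (pi : R -> R) (rho c : R).

Definition penalized_map (u : 'M[R]_(N, d)) : 'M[R]_(N, d) :=
  \matrix_(l, i)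
    (F u l i - rho * (\sum_(j < d | j != i) pi (u l j - c - u l i))).

Lemma solves_penalizedE (u : 'M[R]_(N, d)) :
  solves_penalized F pi rho c u <-> penalized_map u = 0.
Proof.
split=> [Hu|Gu0 i l]; last by move/matrixP/(_ l i): Gu0; rewrite !mxE.
by apply/matrixP => l i; rewrite !mxE Hu.
Qed.

(** All penalty arguments equal [- c] at the origin. This lets the a priori bound be stated with
    [F 0]. *)
Lemma penalized_map0 : 0 <= c -> (forall x, x <= 0 -> pi x = 0) ->
  penalized_map 0 = F 0.
Proof.
move=> c_ge0 pi0; apply/matrixP => l i; rewrite mxE big1 ?mulr0 ?subr0// => j _.
by rewrite pi0// !mxE; lra.
Qed.

Lemma penalized_map_continuous l i : continuous F -> continuous pi ->
  continuous (fun u => penalized_map u l i).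
Proof.
move=> cF cpi; have -> : (fun u => penalized_map u l i) = (fun u =>
    F u l i - rho * (\sum_(j < d | j != i) pi (u l j - c - u l i))).
  by apply/funext => u; rewrite mxE.
move=> u.
apply: (@continuousB _ _ _ (fun v : 'M[R]_(N, d) => F v l i)
  (fun v : 'M[R]_(N, d) => rho * _)).
  exact: (cvg_comp _ _ (cF u) (@coord_continuous _ _ _ l i (F u))).
apply: continuousM; first exact: cst_continuous.
apply: continuous_big => [|j _ {}u]; first exact: add_continuous.
suff : {for u, continuous (fun v : 'M[R]_(N, d) => v l j - c - v l i)}.
  by move=> /cvg_comp; apply; exact: cpi.
apply: continuousB; last exact: coord_continuous.
by apply: continuousB; [exact: coord_continuous|exact: cst_continuous].
Qed.

(** At a maximal entry [(l, i)] of [u - v], each difference [u l j - u l i] is at most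
    [v l j - v l i], so the subtracted penalty is no larger at [u] than at [v]. *)
Lemma penalized_map_monotone gamma : monotonicity_condition F gamma ->
  {homo pi : x y / x <= y} -> 0 <= rho ->
  monotonicity_condition penalized_map gamma.
Proof.
move=> monF pi_homo rho_ge0 u v i l max_li li_ge0.
apply: le_trans (monF u v i l max_li li_ge0) _; rewrite !mxE.
suff : rho * (\sum_(j < d | j != i) pi (u l j - c - u l i)) <=
       rho * (\sum_(j < d | j != i) pi (v l j - c - v l i)) by lra.
apply: ler_wpM2l => //; apply: ler_sum => j _; apply: pi_homo.
by have := max_li l j; rewrite !mxE; lra.
Qed.

End Penalization.

Theorem theorem2p5 (R : realType) (N d : nat) (hN : (1 <= N)%N) (hd : (2 <= d)%N)
  (F : 'M[R]_(N, d) -> 'M[R]_(N, d)) (hF : continuous F)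
  (gamma : R) (hgamma : 0 < gamma) (hmon : monotonicity_condition F gamma)
  (pi : R -> R) (hpi : penalty_function pi)
  (rho : R) (hrho : 0 <= rho) (c : R) (hc : 0 <= c) :
  exists u : 'M[R]_(N, d),
    [/\ solves_penalized F pi rho c u,
        (forall v : 'M[R]_(N, d), solves_penalized F pi rho c v -> v = u)
      & `|u| <= `|F 0| / gamma].
Proof.
have [pi_cont pi_homo pi_npos _] := hpi.
have monG := penalized_map_monotone F pi rho c gamma hmon pi_homo hrho.
have contG l i := penalized_map_continuous F pi rho c l i hF pi_cont.
have [u Gu0] := monotone_zero_exists _ _ hgamma monG contG.
exists u; split; first exact/solves_penalizedE.
(* Uniqueness is comparison in both directions between two zeros. *)
- move=> v /solves_penalizedE Gv0; apply/matrixP => l i; apply/eqP.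
  by rewrite eq_le !(monotone_comparison _ _ hgamma monG)// => k j;
     rewrite Gu0 Gv0.
- rewrite -(penalized_map0 F pi rho c hc pi_npos).
  exact: monotone_zero_bound hgamma monG _ Gu0.
Qed.
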